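(* Let $X$ be a finite $T_0$-space (equivalently, a finite poset). (1) Let $A\subseteq X$ be a contractible open subspace. Then $$\mu(X)=-\sum_{x\in X-A}\mu(\hat U_x).$$ (2) Let $X_0$ be the set of minimal points of $X$. Then $$\mu(X)=\#X_0-1-\sum_{x\in X-X_0}\mu(\hat U_x).$$
   Context: Finite $T_0$-spaces are identified with finite posets; the open sets are the down-sets. $\hat U_x=\{a\in X:a<x\}$. The M\''obius function $\mu(P)$ of a finite poset $P$ is the number of chains of $P$ of odd cardinality minus the number of chains of $P$ of even cardinality, where the empty chain counts as a chain of even cardinality. *)

(* Defs.v *)
From HB Require Import structures.
From mathcomp Require Import all_boot all_order all_algebra.
From mathcomp Require Import all_classical all_reals.
From mathcomp Require Import topology normedtype.

Set Implicit Arguments.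
Unset Strict Implicit.
Unset Printing Implicit Defensive.

Import Order.TTheory GRing.Theory Num.Theory.
Import numFieldNormedType.Exports.

Local Open Scope classical_set_scope.
Local Open Scope ring_scope.

(* [alexandrov X] is an alias of the poset [X] that carries the topology whose
   open sets are the down-sets. *)
Definition alexandrov {d : Order.disp_t} (X : finPOrderType d) : Type := X.

Section Alexandrov.
Context {d : Order.disp_t} (X : finPOrderType d).

HB.instance Definition _ := Finite.on (alexandrov X).

Definition downset (U : set (alexandrov X)) : Prop :=
  forall x y : X, (x <= y)%O -> U y -> U x.

Let downsetT : downset setT. Proof. by []. Qed.

Let downsetI : setI_closed downset.
Proof. by move=> U V dU dV x y xy [Uy Vy]; split; [exact: dU Uy|exact: dV Vy]. Qed.

Let downset_bigU (I : Type) (f : I -> set (alexandrov X)) :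
  (forall i, downset (f i)) -> downset (\bigcup_i f i).
Proof. by move=> df x y xy [i _ fiy]; exists i => //; exact: df fiy. Qed.

HB.instance Definition _ := isOpenTopological.Build (alexandrov X)
  downsetT downsetI downset_bigU.

Lemma alexandrov_openE (U : set (alexandrov X)) : open U = downset U.
Proof. by []. Qed.

Lemma alexandrov_kolmogorov : kolmogorov_space (alexandrov X).
Proof.
have nle (x y : X) : ~~ (y <= x)%O ->
    exists2 U, U \in nbhs (x : alexandrov X) & (y : alexandrov X) \in ~` U.
  move=> nyx; exists [set z : X | (z <= x)%O]; rewrite inE /=; last exact/negP.
  apply: open_nbhs_nbhs; split; last exact: lexx.
  by rewrite alexandrov_openE => z w zw; exact: le_trans.
move=> x y xy; have [yx|/nle[U xU yU]] := boolP ((y : X) <= x)%O; last first.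
  by exists U; left.
have /nle[U yU xU] : ~~ ((x : X) <= y)%O.
  by apply: contra xy => xy; apply/eqP/le_anti; rewrite xy.
by exists U; right.
Qed.

End Alexandrov.

(* The subspace [A] of [T] is contractible: its identity is homotopic to a
   constant map.  [H] is total, but only its values on [A `*` `[0, 1]] matter:
   [{within _, continuous H}] uses the subspace topology there. *)
Definition contractible (R : realType) (T : topologicalType) (A : set T) : Prop :=
  exists2 a : T, A a & exists H : T * R -> T,
    [/\ {within A `*` `[0, 1], continuous H},
        forall x t, A x -> t \in `[0, 1] -> A (H (x, t)),
        forall x, A x -> H (x, 0) = x &
        forall x, A x -> H (x, 1) = a].

Section Mobius.
Context {d : Order.disp_t} {X : finPOrderType d}.
Implicit Types P C : {set X}.

Definition chain_of P C : bool :=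
  (C \subset P) && [forall x in C, forall y in C, (x >=< y)%O].

Definition mobius P : int :=
  #|[set C : {set X} | chain_of P C && odd #|C|]%SET|%:Z
  - #|[set C : {set X} | chain_of P C && ~~ odd #|C|]%SET|%:Z.

Definition below (x : X) : {set X} := [set a : X | (a < x)%O]%SET.

Definition min_points : {set X} := [set x : X | [forall y : X, ~~ (y < x)%O]]%SET.

End Mobius.

Arguments min_points {d} X.

(* Main.v *)
Require Import Defs.
From mathcomp Require Import all_boot all_order all_algebra.
From mathcomp Require Import all_classical all_reals.
From mathcomp Require Import topology normedtype.

Import Order.TTheory GRing.Theory Num.Theory.
Import numFieldNormedType.Exports.
Local Open Scope classical_set_scope.
Local Open Scope ring_scope.

(** The number mobius P is minus the sum of (-1)^|C| over the chains C of P,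
    that is, the reduced Euler characteristic of the order complex of P.

    Expansion along a down-set.  Let A be a down-set of X.  A chain of X that
    is not contained in A has its greatest element x outside A, and removing x
    leaves an arbitrary chain of below x.  Hence
    mobius X = mobius A - sum_(x notin A) mobius (below x); this is
    [mobius_downsets], obtained by deleting maximal points one at a time with
    [mobius_deletion].  The second formula is the case of the antichain of
    minimal points, whose only chains are the empty one and the singletons.
    For the first formula it remains to see that mobius A = 0 when A is
    contractible.

    Contractible sets ([mobius_contractible]).  The argument is a Lefschetz
    fixed point theorem.  For a monotone f : A -> A, a chain that f maps onto
    itself is fixed pointwise, so mobius (Fix f) is the reduced Lefschetz
    number of f and should be a homotopy invariant.  This is proved directly:
    - if f <= g are monotone then mobius (Fix f) = mobius (Fix g)
      ([mobius_fixpoints_le]).  One passes from f to g by changing one value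
      at a time; when such a change destroys the fixed point x, the fixed
      points comparable with x are all comparable with one other fixed point
      w, so the link of x is a cone and deleting x does not change mobius;
    - if H is a homotopy through self-maps of A, then by finiteness of A each
      t has a neighbourhood of parameters s with H(-, s) <= H(-, t), because
      the points below H(y, t) form an open set.  So
      t |-> mobius (Fix H(-, t)) is locally constant, hence constant on the
      connected interval [0, 1].
    At t = 0 the fixed point set is A, and at t = 1 it is a single point,
    for which mobius vanishes. *)

(** * Chains, deletion of a point, and cones *)

Lemma chain_ofP {d : Order.disp_t} {X : finPOrderType d} (P C : {set X}) :
  reflect [/\ {subset C <= P} & {in C &, forall x y, (x >=< y)%O}] (chain_of P C).
Proof.
apply: (iffP andP) => [[/fintype.subsetP CP /forall_inP cC]|[CP cC]]; split => //.
- by move=> x y xC yC; have /forall_inP := cC x xC; apply.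
- exact/fintype.subsetP.
- by apply/forall_inP => x xC; apply/forall_inP => y yC; exact: cC.
Qed.

Lemma mobiusE {d : Order.disp_t} {X : finPOrderType d} (P : {set X}) :
  mobius P = - \sum_(C | chain_of P C) (-1) ^+ #|C|.
Proof.
rewrite (bigID (fun C : {set X} => odd #|C|)) /= opprD /mobius.
congr (_ + _); first rewrite -[LHS]opprK; congr (- _).
  rewrite (eq_bigr (fun=> -1)) => [|C /andP[_ oC]]; last first.
    by rewrite -signr_odd oC.
  by rewrite sumrN sumr_const -mulr_natl mulr1 natz cardsE.
rewrite (eq_bigr (fun=> 1)) => [|C /andP[_ /negbTE oC]]; last first.
  by rewrite -signr_odd oC.
by rewrite sumr_const -mulr_natl mulr1 natz cardsE.
Qed.

Definition link {d : Order.disp_t} {X : finPOrderType d} (P : {set X}) (x : X)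
  : {set X} := [set y in P | (y != x) && (y >=< x)%O]%SET.

(** The chains of [P] through [x] are the sets [x |: C] for [C] a chain of the
    link of [x]; adding [x] changes the parity, whence the minus sign. *)
Lemma mobius_deletion {d : Order.disp_t} {X : finPOrderType d}
    (P : {set X}) (x : X) : x \in P ->
  mobius P = mobius (P :\ x) - mobius (link P x).
Proof.
move=> xP; rewrite !mobiusE (bigID (fun C : {set X} => x \in C)) /=.
rewrite opprD addrC; congr (_ + _); congr (- _).
  apply: eq_bigl => C; apply/andP/chain_ofP => [[/chain_ofP[CP cC] xC]|[CP cC]].
    split => // y yC; rewrite !inE CP // andbT.
    by apply: contraNneq xC => <-.
  split; last by apply/negP => /CP; rewrite !inE eqxx.
  by apply/chain_ofP; split => // y /CP; rewrite !inE => /andP[].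
rewrite (reindex_onto (fun C => x |: C) (fun C => C :\ x)) /=; last first.
  by move=> C /andP[_ xC]; rewrite finset.setD1K.
rewrite -sumrN; apply: eq_big => [C|C].
  apply/andP/chain_ofP => [[/andP[/chain_ofP[CP cC] _] /eqP xC]|[CP cC]].
    have nxC : x \notin C by rewrite -xC !inE eqxx.
    split=> [y yC|y z yC zC]; last by apply: cC; rewrite !inE (yC, zC) orbT.
    rewrite !inE CP ?inE ?yC ?orbT //= cC ?inE ?yC ?eqxx ?orbT // andbT.
    by apply: contraNneq nxC => <-.
  have nxC : x \notin C by apply/negP => /CP; rewrite !inE eqxx andbF.
  rewrite finset.setU11 andbT finset.setU1K //; split => //; apply/chain_ofP; split.
    by move=> y; rewrite !inE => /predU1P[->//|/CP]; rewrite !inE => /andP[].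
  move=> y z; rewrite !inE.
  move=> /predU1P[->|yC] /predU1P[->|zC]; rewrite ?comparablexx //; last exact: cC.
    by have := CP _ zC; rewrite !inE comparable_sym => /and3P[].
  by have := CP _ yC; rewrite !inE => /and3P[].
move=> /andP[_ /eqP xC]; have nxC : x \notin C by rewrite -xC !inE eqxx.
by rewrite finset.cardsU1 nxC exprS mulN1r.
Qed.

(** Deleting the apex [w] leaves exactly the link of [w], so the two terms of
    the deletion formula cancel. *)
Lemma mobius_cone {d : Order.disp_t} {X : finPOrderType d}
    (P : {set X}) (w : X) : w \in P -> {in P, forall y, (y >=< w)%O} ->
  mobius P = 0.
Proof.
move=> wP cw; rewrite (mobius_deletion P w wP).
suff -> : link P w = P :\ w by rewrite subrr.
apply/setP => y; rewrite !inE andbC -andbA; congr (_ && _).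
by have [/cw->|] := boolP (y \in P); rewrite ?andbF.
Qed.

(** The order complex of [P] collapses onto that of [P :\ x], since the link of
    [x] is a cone with apex [w].  Stating the domination with comparability
    alone makes the lemma cover both a [w] above [x] and a [w] below it. *)
Lemma mobius_dominated {d : Order.disp_t} {X : finPOrderType d}
    (P : {set X}) (x w : X) :
    x \in P -> w \in P -> w != x -> (w >=< x)%O ->
    {in P, forall y, (y >=< x)%O -> (y >=< w)%O} ->
  mobius P = mobius (P :\ x).
Proof.
move=> xP wP wx cwx cw; rewrite (mobius_deletion P x xP).
rewrite (mobius_cone (link P x) w) ?subr0 // ?inE ?wP ?wx //.
by move=> y; rewrite !inE => /and3P[yP _]; exact: cw.
Qed.

Lemma mobius_set0 {d : Order.disp_t} {X : finPOrderType d} :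
  mobius (finset.set0 : {set X}) = -1.
Proof.
rewrite mobiusE (big_pred1 finset.set0) ?cards0 // => C.
apply/chain_ofP/eqP => [[CP _]|->].
  by apply/setP => y; rewrite inE; apply/negP => /CP; rewrite inE.
by split => // y; rewrite inE.
Qed.

(** * Expansion along a down-set *)

Lemma exists_maximal {d : Order.disp_t} {X : finPOrderType d} (S : {set X}) :
  S != finset.set0 -> exists2 x, x \in S & {in S, forall y, ~~ (x < y)%O}.
Proof.
case/finset.set0Pn => z0 z0S.
(* The number of points below x increases strictly with x. *)
case: (arg_maxnP (fun x : X => #|below x|) z0S) => x xS xmax.
exists x => // y yS; apply/negP => xy; have := xmax y yS.
apply/negP; rewrite -ltnNge; apply/proper_card/fintype.properP.
split; first by apply/fintype.subsetP => u; rewrite !inE => /lt_trans; apply.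
by exists x; rewrite !inE ?ltxx.
Qed.

(** Deleting a point [x] maximal in [B] and outside [A] costs
    [mobius (below x)]: the link of [x] in [B] consists of the points below
    [x], all of which are in the down-set [B].  A point maximal in [B :\: A] is
    maximal in [B] because [A] is a down-set. *)
Lemma mobius_downsets {d : Order.disp_t} {X : finPOrderType d}
    (A B : {set X}) :
    (forall x y : X, (x <= y)%O -> y \in A -> x \in A) ->
    (forall x y : X, (x <= y)%O -> y \in B -> x \in B) -> A \subset B ->
  mobius B = mobius A - \sum_(x in B :\: A) mobius (below x).
Proof.
move=> dA; have [n] := ubnP #|B :\: A|; elim: n B => // n IH B.
rewrite ltnS => leBn dB sAB.
have [BA|] := eqVneq (B :\: A) finset.set0.
  rewrite BA big_set0 subr0; congr mobius; apply/eqP.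
  by rewrite finset.eqEsubset sAB andbT -finset.setD_eq0 BA.
move=> /exists_maximal[x xBA xmax].
have [xA xB] : x \notin A /\ x \in B by apply/andP; rewrite -finset.in_setD.
have maxx y : y \in B -> (x < y)%O = false.
  move=> yB; apply/negP => xy.
  have yBA : y \in B :\: A.
    rewrite inE yB andbT; apply: contra xA; exact/dA/ltW.
  by move: xy; apply/negP/xmax.
have eBA : B :\ x :\: A = (B :\: A) :\ x.
  by apply/setP => y; rewrite !inE andbCA.
rewrite (mobius_deletion B x xB) (big_setD1 x) //= IH; last 3 first.
- by rewrite eBA; apply: leq_trans leBn; rewrite [leqRHS](cardsD1 x) xBA.
- move=> u v uv; rewrite !inE => /andP[vx vB]; rewrite (dB u v) // andbT.
  apply: contraNneq vx => ux; rewrite eq_le; move: (maxx v vB).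
  by rewrite -ux uv lt_neqAle uv andbT => /negbFE/eqP->; rewrite lexx.
- by rewrite finset.subsetD1 sAB.
suff -> : link B x = below x.
  rewrite eBA; move: (mobius A) (mobius (below x)) (\sum_(_ in _) _) => a b c.
  by rewrite opprD addrA addrAC.
apply/setP => y; rewrite !inE; have [yB|nyB] /= := boolP (y \in B).
  rewrite lt_neqAle; case: eqVneq => //= yx.
  by rewrite /Order.comparable (le_eqVlt x) maxx // eq_sym (negbTE yx) !orbF.
by apply/esym/negP => yx; move/negP: nyB; apply; apply: dB xB; exact: ltW.
Qed.

Lemma mobius_antichain {d : Order.disp_t} {X : finPOrderType d} (P : {set X}) :
  {in P, forall x, below x = finset.set0} -> mobius P = #|P|%:Z - 1.
Proof.
move=> minP; rewrite (mobius_downsets finset.set0 P) ?finset.sub0set //; last 2 first.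
- by move=> x y _; rewrite inE.
- move=> x y; rewrite le_eqVlt => /predU1P[->//|xy] /minP/setP/(_ x).
  by rewrite !inE xy.
rewrite finset.setD0 (eq_bigr (fun=> -1)) => [|x /minP->]; last exact: mobius_set0.
by rewrite mobius_set0 sumrN opprK sumr_const addrC natz.
Qed.

(** * Fixed points of comparable monotone maps *)

Definition endomap {d : Order.disp_t} {X : finPOrderType d}
    (A : {set X}) (f : X -> X) : Prop :=
  {in A, forall x, f x \in A} /\ {in A &, {homo f : x y / (x <= y)%O}}.

Definition fixpoints {X : finType} (A : {set X}) (f : X -> X) : {set X} :=
  [set x in A | f x == x]%SET.

(** The iterates of [f] at [z] increase and stabilize at [w]; monotonicity keeps
    them below every fixed point above [z]. *)
Lemma least_fixpoint_above {d : Order.disp_t} {X : finPOrderType d}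
    (A : {set X}) (f : X -> X) (z : X) :
    endomap A f -> z \in A -> (z <= f z)%O ->
  exists w, [/\ w \in A, f w = w, (z <= w)%O &
    {in A, forall y, f y = y -> (z <= y)%O -> (w <= y)%O}].
Proof.
move=> [fA fm]; have [n] := ubnP #|[set u | (z < u)%O]%SET|.
elim: n z => // n IH z; rewrite ltnS => len zA.
rewrite le_eqVlt => /predU1P[fz|zfz]; first by exists z; split.
have [|||w [wA fw fzw wmin]] := IH (f z).
- apply: leq_trans len; apply/proper_card/fintype.properP; split.
    by apply/fintype.subsetP => u; rewrite !inE; exact: lt_trans.
  by exists (f z); rewrite !inE ?ltxx.
- exact: fA.
- by apply: fm; rewrite ?fA // ltW.
- exists w; split => //; first exact/(le_trans _ fzw)/ltW.
  by move=> y yA fy zy; apply: wmin => //; rewrite -fy; exact: fm.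
Qed.

Lemma greatest_fixpoint_below {d : Order.disp_t} {X : finPOrderType d}
    (A : {set X}) (f : X -> X) (z : X) :
    endomap A f -> z \in A -> (f z <= z)%O ->
  exists w, [/\ w \in A, f w = w, (w <= z)%O &
    {in A, forall y, f y = y -> (y <= z)%O -> (y <= w)%O}].
Proof.
move=> [fA fm]; apply: (@least_fixpoint_above _ X^d A f z).
by split => // x y xA yA; exact: fm.
Qed.

(** Replacing [f] by [g] loses the single fixed point [x], and [w] dominates
    [x] in the fixed points of [f]. *)
Lemma mobius_fixpoints_drop {d : Order.disp_t} {X : finPOrderType d}
    (A : {set X}) (f g : X -> X) (x w : X) :
    {in A, forall y, y != x -> f y = g y} ->
    x \in A -> f x = x -> g x != x ->
    w \in A -> g w = w -> (w >=< x)%O ->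
    {in A, forall y, f y = y -> (y >=< x)%O -> (y >=< w)%O} ->
  mobius (fixpoints A f) = mobius (fixpoints A g).
Proof.
move=> fg xA fx gx wA gw wx domw.
have wnx : w != x by apply: contraNneq gx => <-; rewrite gw.
rewrite (mobius_dominated _ x w) ?inE ?xA ?wA ?fx ?fg ?gw ?eqxx //; last first.
  by move=> y; rewrite inE => /andP[yA /eqP fy]; exact: domw.
congr mobius; apply/setP => y; rewrite !inE.
have [->|yx] := eqVneq y x; first by rewrite (negbTE gx) andbF.
by have [yA|//] := boolP (y \in A); rewrite fg.
Qed.

(** Only [x] can enter or leave the set of fixed points.  If it leaves, the
    dominating point is the stable value [w] of the iterates of [g] at
    [g x]: a fixed point [y > x] satisfies [y = g y >= g x], hence [y >= w].
    If it enters, the roles of [f] and [g] and the order are reversed. *)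
Lemma mobius_fixpoints_step {d : Order.disp_t} {X : finPOrderType d}
    (A : {set X}) (f g : X -> X) (x : X) :
    endomap A f -> endomap A g ->
    {in A, forall y, y != x -> f y = g y} -> x \in A -> (f x < g x)%O ->
  mobius (fixpoints A f) = mobius (fixpoints A g).
Proof.
move=> fE gE fg xA fgx.
have [fA fm] := fE; have [gA gm] := gE.
have [fx|fx] := eqVneq (f x) x.
  have xgx : (x < g x)%O by rewrite -{1}fx.
  have [||w [wA gw zw wmin]] := least_fixpoint_above A g (g x) gE.
  - exact: gA.
  - by apply: gm; rewrite ?gA // ltW.
  have xw : (x < w)%O by exact: lt_le_trans zw.
  apply: (mobius_fixpoints_drop A f g x w) => //.
  - by rewrite gt_eqF.
  - by rewrite comparable_sym /Order.comparable ltW.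
  move=> y yA fy /orP[yx|].
    by rewrite /Order.comparable (le_trans yx (ltW xw)).
  rewrite le_eqVlt => /predU1P[<-|xy]; first by rewrite /Order.comparable ltW.
  have gy : g y = y by rewrite -fg // gt_eqF.
  rewrite /Order.comparable wmin ?orbT // -gy.
  by apply: gm; rewrite // ltW.
have [gx|gx] := eqVneq (g x) x.
  have xfx : (f x < x)%O by rewrite -{2}gx.
  have [||w [wA fw zw wmax]] := greatest_fixpoint_below A f (f x) fE.
  - exact: fA.
  - by apply: fm; rewrite ?fA // ltW.
  have wx : (w < x)%O by exact: le_lt_trans zw xfx.
  apply/esym/(mobius_fixpoints_drop A g f x w) => //.
  - by move=> y yA yx; rewrite fg.
  - by rewrite /Order.comparable ltW.
  move=> y yA gy; rewrite comparable_sym => /orP[xy|].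
    by rewrite comparable_sym /Order.comparable (le_trans (ltW wx) xy).
  rewrite le_eqVlt => /predU1P[->|yx].
    by rewrite comparable_sym /Order.comparable ltW.
  have fy : f y = y by rewrite fg // lt_eqF.
  rewrite /Order.comparable wmax // -fy.
  by apply: fm; rewrite // ltW.
congr mobius; apply/setP => y; rewrite !inE.
have [->|yx] := eqVneq y x; first by rewrite (negbTE gx) (negbTE fx).
by have [yA|//] := boolP (y \in A); rewrite fg.
Qed.

(** Changing [f x] to [g x] at a point [x] maximal among those where the maps
    differ keeps the map monotone: below [x] one has [f y <= f x <= g x], and
    above [x] the map already agrees with [g]. *)
Lemma mobius_fixpoints_le {d : Order.disp_t} {X : finPOrderType d}
    (A : {set X}) (f g : X -> X) :
    endomap A f -> endomap A g -> {in A, forall x, (f x <= g x)%O} ->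
  mobius (fixpoints A f) = mobius (fixpoints A g).
Proof.
move=> fE gE; have [n] := ubnP #|[set x in A | f x != g x]%SET|.
elim: n f fE => // n IH f fE; rewrite ltnS => len fg.
have [fA fm] := fE; have [gA gm] := gE.
have [D0|] := eqVneq [set x in A | f x != g x]%SET finset.set0.
  congr mobius; apply/setP => y; rewrite !inE.
  have [yA|//] := boolP (y \in A); have /setP/(_ y) := D0.
  by rewrite !inE yA => /negbFE/eqP->.
move=> /exists_maximal[x]; rewrite inE => /andP[xA fgx] xmax.
have above y : y \in A -> (x < y)%O -> f y = g y.
  move=> yA xy; apply/eqP; apply: contraTT xy => fgy.
  by apply: xmax; rewrite inE yA.
pose h y := if y == x then g x else f y.
have hE : endomap A h.
  split=> [y yA|y z yA zA yz]; rewrite /h; first by case: ifP => _; [exact: gA|exact: fA].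
  case: eqVneq => [yx|_]; case: eqVneq => [zx|zx] //; last exact: fm.
    rewrite above //; first by rewrite -yx; exact: gm.
    by rewrite -yx lt_neqAle yz yx eq_sym zx.
  by apply: le_trans (fg _ xA); rewrite -zx; exact: fm.
have hx : h x = g x by rewrite /h eqxx.
have hf y : y != x -> f y = h y by rewrite /h => /negbTE->.
rewrite (mobius_fixpoints_step A f h x) //; first last.
- by rewrite hx lt_neqAle fgx fg.
- by move=> y _; exact: hf.
apply: IH => //.
  apply: leq_trans len; apply/proper_card/fintype.properP; split.
    apply/fintype.subsetP => y; rewrite !inE => /andP[-> /=].
    by have [->|/hf->//] := eqVneq y x; rewrite hx eqxx.
  by exists x; rewrite !inE xA ?fgx // hx eqxx.
by move=> y yA; have [->|/hf<-] := eqVneq y x; [rewrite hx|exact: fg].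
Qed.

(** * Homotopies *)

Lemma segment_locally_constant {R : realType} {T : Type} (phi : R -> T) (a b : R) :
    a <= b ->
    (forall t, t \in `[a, b] ->
       \forall s \near t, s \in `[a, b] -> phi s = phi t) ->
  phi a = phi b.
Proof.
move=> ab lc.
pose B : set R := [set t | t \in `[a, b] /\ phi t = phi a].
suff : B = `[a, b]%classic.
  move=> /seteqP[_ /(_ b)]; rewrite /= bound_itvE => /(_ ab)[_ ->//].
apply: segment_connected.
- by exists a; split; rewrite ?bound_itvE.
- exists ([set t | t \in `[a, b] -> phi t = phi a]^°); first exact: open_interior.
  apply/seteqP; split => t /=.
    move=> [tI pt]; split=> //; apply: filterS (lc t tI) => s ps /ps->//.
  by move=> [tI /interior_subset pt]; split=> //; exact: pt.
- exists (~` [set t | t \in `[a, b] -> phi t <> phi a]^°).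
    by rewrite closedC; exact: open_interior.
  apply/seteqP; split => t /=.
    by move=> [tI pt]; split=> // /interior_subset; apply.
  move=> [tI nt]; split => //; apply: contrapT => pt; apply: nt.
  by apply: filterS (lc t tI) => s ps /ps->.
Qed.

(** The preimage of the open set of points below [H (y, t)] contains the trace
    on [A `*` I] of a box around [(y, t)], and every neighbourhood of [y] contains all [x <= y].  With
    [s = t] this says that [H (-, t)] is monotone; with [x = y] it bounds the
    nearby maps by [H (-, t)]. *)
Lemma homotopy_near_le {R : realType} {d : Order.disp_t} {X : finPOrderType d}
    (A : set (alexandrov X)) (I : set R) (H : alexandrov X * R -> alexandrov X)
    (y : X) (t : R) :
    {within A `*` I, continuous H} -> A y -> I t ->
  \forall s \near t, I s ->
    forall x : X, A x -> (x <= y)%O -> ((H (x, s) : X) <= H (y, t))%O.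
Proof.
move=> /subspace_continuousP/(_ (y, t)) cH Ay It.
have /(cH (conj Ay It)) : nbhs (H (y, t)) [set z : X | (z <= H (y, t))%O].
  apply: open_nbhs_nbhs; split; last exact: lexx.
  by rewrite alexandrov_openE => u v uv; exact: le_trans.
rewrite /= /nbhs /= => -[[U V] /= [Uy Vt] UV].
have Udown x : (x <= y)%O -> U x.
  move=> xy; move: Uy; rewrite nbhsE => -[W [oW Wy] WU]; apply: WU.
  by move: oW; rewrite alexandrov_openE => /(_ x y xy); apply.
apply: filterS Vt => s Vs Is x Ax xy.
by apply: (UV (x, s)); split => //; exact: Udown.
Qed.

(** The number [mobius (fixpoints A (H (-, t)))] does not depend on [t]; the
    ends [t = 0] and [t = 1] give [mobius A] and the value at one point. *)
Lemma mobius_contractible {R : realType} {d : Order.disp_t}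
    {X : finPOrderType d} (A : {set X}) :
  contractible R ([set` A] : set (alexandrov X)) -> mobius A = 0.
Proof.
move=> [a Aa [H [cH HA H0 H1]]].
pose h t x : X := H (x, t).
have hE t : t \in `[0, 1] -> endomap A (h t).
  move=> tI; split=> [x xA|x y xA yA xy]; first exact: HA.
  have tI' : `[(0 : R), 1]%classic t by [].
  have /nbhs_singleton := homotopy_near_le _ _ _ y t cH yA tI'.
  exact.
have h0 : fixpoints A (h 0) = A.
  apply/setP => x; rewrite inE; have [xA|//] := boolP (x \in A).
  by apply/eqP; exact: H0.
have h1 : fixpoints A (h 1) = [set a]%SET.
  apply/setP => x; rewrite !inE; apply/andP/eqP => [[xA /eqP<-]|->].
    exact: H1.
  by split=> //; apply/eqP; exact: H1.
rewrite -{1}h0.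
rewrite (segment_locally_constant (fun t => mobius (fixpoints A (h t))) 0 1) //.
  rewrite h1 (mobius_cone _ a) ?inE // => x; rewrite inE => /eqP->.
  exact: comparablexx.
move=> t tI; have tI' : `[(0 : R), 1]%classic t by [].
have near_le (y : X) :
    \forall s \near t, y \in A -> s \in `[0, 1] -> (h s y <= h t y)%O.
  have [yA|nyA] := boolP (y \in A); last first.
    by apply: (nearW (F:=nbhs t)) => s; rewrite ?(negbTE nyA).
  apply: filterS (homotopy_near_le _ _ _ y t cH yA tI') => s hs _ sI.
  exact: hs.
apply: filterS (filter_forall (F:=nbhs t) _ near_le) => s hs sI.
by apply: mobius_fixpoints_le; [exact: hE|exact: hE|move=> y yA; exact: hs].
Qed.

Theorem corollary4p8 (R : realType) (d : Order.disp_t) (X : finPOrderType d) :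
  (forall A : {set X},
     open ([set` A] : set (alexandrov X)) ->
     contractible R ([set` A] : set (alexandrov X)) ->
     mobius [set: X]%SET = - \sum_(x in ~: A) mobius (below x)) /\
  mobius [set: X]%SET =
    #|min_points X|%:Z - 1 - \sum_(x in ~: min_points X) mobius (below x).
Proof.
have expand (A : {set X}) : (forall x y : X, (x <= y)%O -> y \in A -> x \in A) ->
    mobius [set: X]%SET = mobius A - \sum_(x in ~: A) mobius (below x).
  move=> dA; rewrite -finset.setTD; exact: mobius_downsets.
split=> [A oA cA|].
  by rewrite (expand A) ?(mobius_contractible A cA) ?sub0r.
have below_min (x : X) : x \in min_points X -> below x = finset.set0.
  rewrite inE => /forallP minx; apply/setP => y; rewrite !inE.
  exact/negbTE/minx.
rewrite (expand (min_points X)) ?(mobius_antichain (min_points X)) //.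
move=> x y; rewrite le_eqVlt => /predU1P[->//|xy]; rewrite !inE.
by move=> /forallP/(_ x); rewrite xy.
Qed.
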